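(* Let $k\ge 2$ be an integer and let $\theta_k\in S_k$ be the permutation whose one-line notation is $k\,1\,2\,\cdots\,(k-2)\,(k-1)$. Then for every $n\geq k$, $$\langle S_n(132,231,321,\theta_k)\rangle\cong S_{k-1}.$$
   Context: $S_n$ is the symmetric group on $[n]$, permutations written in one-line notation. A permutation $\pi\in S_n$ contains the pattern $\tau\in S_m$ if some subsequence of $\pi$ of length $m$ is order-isomorphic to $\tau$; otherwise it avoids $\tau$. $S_n(\tau_1,\dots,\tau_j)$ is the set of permutations in $S_n$ avoiding each $\tau_i$, and $\langle A\rangle$ is the subgroup of $S_n$ generated by $A$. *)

(* Defs.v *)
From mathcomp Require Import all_boot all_fingroup.

Set Implicit Arguments.
Unset Strict Implicit.
Unset Printing Implicit Defensive.

(* Positions and values are 0-based in 'I_n; one_line gives the 1-based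
   one-line notation. *)
Definition one_line (n : nat) (s : 'S_n) : seq nat :=
  [seq (s i).+1 | i : 'I_n].

(* f picks the positions of a subsequence of s order-isomorphic to t. *)
Definition is_occurrence (m n : nat) (t : 'S_m) (s : 'S_n)
    (f : {ffun 'I_m -> 'I_n}) : bool :=
  [forall i : 'I_m, forall j : 'I_m,
    ((i < j) ==> (f i < f j)) && ((t i < t j) == (s (f i) < s (f j)))].

Definition contains (m n : nat) (s : 'S_n) (t : 'S_m) : bool :=
  [exists f : {ffun 'I_m -> 'I_n}, is_occurrence t s f].

Definition avoids (m n : nat) (s : 'S_n) (t : 'S_m) : bool := ~~ contains s t.

Definition p132 : 'S_3 := tperm (@Ordinal 3 1 isT) (@Ordinal 3 2 isT).
Definition p231 : 'S_3 := perm (@ordS_inj 3).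
Definition p321 : 'S_3 := perm (@rev_ord_inj 3).

(* ord_pred is the cyclic predecessor: 0 |-> k - 1 and i |-> i - 1 for i > 0. *)
Definition theta (k : nat) : 'S_k := perm (@ord_pred_inj k).

Lemma one_line_p132 : one_line p132 = [:: 1; 3; 2].
Proof.
by rewrite /one_line /image_mem !enum_ordSl /= !permE
  (size0nil (size_enum_ord 0)).
Qed.

Lemma one_line_p231 : one_line p231 = [:: 2; 3; 1].
Proof.
by rewrite /one_line /image_mem !enum_ordSl /= !permE
  (size0nil (size_enum_ord 0)).
Qed.

Lemma one_line_p321 : one_line p321 = [:: 3; 2; 1].
Proof.
by rewrite /one_line /image_mem !enum_ordSl /= !permE
  (size0nil (size_enum_ord 0)).
Qed.

Lemma one_line_theta (k : nat) :
  0 < k -> one_line (theta k) = k :: iota 1 k.-1.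
Proof.
case: k => // k _; rewrite /one_line /image_mem enum_ordSl /= permE /=.
rewrite modn_small //; congr cons.
rewrite -map_comp -[in RHS](addn0 1) iotaDl -val_enum_ord -!map_comp.
apply: eq_map => i /=; rewrite permE /=.
by rewrite add0n modnDr modn_small // leqW.
Qed.

(* Main.v *)
Require Import Defs.
From mathcomp Require Import all_boot all_fingroup zify.

(** A permutation avoids 132, 231 and 321 exactly when its values increase from
    the second position on, i.e. when it is one of the cycles
    [b 0 1 ... (b-1) (b+1) ... (n-1)] (0-based).  Such a cycle avoids [theta k]
    exactly when [b < k - 1], so it fixes every point [>= k - 1]; and these
    cycles generate all permutations of [{0, ..., k-2}], since powers of the
    cycle starting with [j] can move any point [a <= j] to [j]. *)

Set Implicit Arguments.
Unset Strict Implicit.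
Unset Printing Implicit Defensive.

(** * Prefix cycles and the subgroups they generate *)

Definition prefix_cycle_fun (b i : nat) : nat :=
  if b < i then i else if i == 0 then b else i.-1.

(** A form made for linear arithmetic: the last case uses a successor, so no truncated predecessor
    reaches [lia]. *)
Lemma prefix_cycle_funP b i :
  b < i /\ prefix_cycle_fun b i = i
  \/ i = 0 /\ prefix_cycle_fun b i = b
  \/ 0 < i <= b /\ (prefix_cycle_fun b i).+1 = i.
Proof.
by rewrite /prefix_cycle_fun; case: (ltnP b i) => ?; case: (i =P 0) => ?; lia.
Qed.

Section PrefixCycle.
Variable n : nat.
Implicit Types (b i j : 'I_n) (s : 'S_n).

Lemma prefix_cycle_fun_proof b i : prefix_cycle_fun b i < n.
Proof.
by have := ltn_ord b; have := ltn_ord i; have := prefix_cycle_funP b i; lia.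
Qed.

Lemma prefix_cycle_fun_inj b :
  injective (fun i => Ordinal (prefix_cycle_fun_proof b i)).
Proof.
move=> i j /(congr1 val) /= e; apply: val_inj => /=; move: e.
by have := prefix_cycle_funP b i; have := prefix_cycle_funP b j; lia.
Qed.

Definition prefix_cycle b : 'S_n := perm (@prefix_cycle_fun_inj b).

Lemma prefix_cycleE b i : prefix_cycle b i = prefix_cycle_fun b i :> nat.
Proof. by rewrite permE. Qed.

Definition increasing_tail s :=
  forall i j, 0 < i -> i < j -> s i < s j.

Lemma prefix_cycle_increasing b : increasing_tail (prefix_cycle b).
Proof.
move=> i j; rewrite !prefix_cycleE.
by have := prefix_cycle_funP b i; have := prefix_cycle_funP b j; lia.
Qed.

Lemma increasing_perm_ge s :
  (forall i j, i < j -> s i < s j) -> forall i, i <= s i.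
Proof.
move=> incr [i]; elim: i => [//|i IHi] ltin /=.
exact: leq_ltn_trans (IHi (ltnW ltin)) (incr (Ordinal (ltnW ltin)) _ _).
Qed.

(** The inverse of [s] is increasing too, and no increasing permutation lowers a point: [s] gives
    [i <= s i], and its inverse, taken at [s i], gives [s i <= i]. *)
Lemma increasing_perm1 s : (forall i j, i < j -> s i < s j) -> s = 1%g.
Proof.
move=> incr; apply/permP=> i; rewrite perm1; apply: val_inj => /=.
have incrV j1 j2 : j1 < j2 -> s^-1%g j1 < s^-1%g j2.
  move=> lt12; case: (ltngtP (s^-1%g j1) (s^-1%g j2)) => // [/incr|/val_inj].
    by rewrite !permKV; lia.
  by move=> /perm_inj e; move: lt12; rewrite e ltnn.
have := increasing_perm_ge incrV (s i); rewrite permK => ge_si.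
by apply/eqP; rewrite eqn_leq ge_si increasing_perm_ge.
Qed.

(** The cycle [c] has the same first value as [s], so the quotient [u] fixes 0 and keeps positive
    positions positive. As [s] and [c] both increase there, [u] is increasing, hence trivial. *)
Lemma increasing_tail_prefix_cycle s i0 :
  i0 = 0 :> nat -> increasing_tail s -> s = prefix_cycle (s i0).
Proof.
move=> i00 incr; set c := prefix_cycle _.
apply/eqP; rewrite eq_mulgV1; apply/eqP; set u : 'S_n := (s * c^-1)%g.
apply: increasing_perm1 => i j ltij.
have e i' : c (u i') = s i' :> nat by rewrite -permM mulgKV.
have neq (x : 'I_n) : 0 < x -> s x <> s i0 :> nat.
  by move=> x_gt0 /val_inj/perm_inj xi; move: x_gt0; rewrite xi i00.
have := e i; have := e j; rewrite !prefix_cycleE.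
have := prefix_cycle_funP (s i0) (u i).
have := prefix_cycle_funP (s i0) (u j).
case: (posnP i) => [zi|i_gt0].
  have -> : i = i0 by apply: val_inj; rewrite /= zi i00.
  by have := neq j (leq_ltn_trans (leq0n i) ltij); lia.
have := incr _ _ i_gt0 ltij.
by have := neq i i_gt0; have := neq j (ltn_trans i_gt0 ltij); lia.
Qed.

Lemma prefix_cycle_exp b i i0 : i0 = 0 :> nat -> i <= b ->
  (prefix_cycle b ^+ i)%g i = i0.
Proof.
move=> i00; case: i => i; elim: i => [|i IHi] ltin /= leib.
  by rewrite perm1; apply: val_inj; rewrite /= i00.
rewrite expgS permM -(IHi (ltnW ltin) (ltnW leib)); congr fun_of_perm.
apply: val_inj; rewrite /= prefix_cycleE /=.
by have := prefix_cycle_funP b i.+1; lia.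
Qed.

Lemma prefix_cycles_gen (m : nat) (H : {group 'S_n}) s : m <= n ->
  (forall b, b < m -> prefix_cycle b \in H) ->
  (forall i, m <= i -> s i = i) -> s \in H.
Proof.
elim: m s => [|m IHm] s le_mn Hc fix_s.
  have -> : s = 1%g by apply/permP=> i; rewrite perm1 fix_s.
  exact: group1.
pose b := Ordinal le_mn; pose i0 := Ordinal (leq_ltn_trans (leq0n m) le_mn).
have Hb : prefix_cycle b \in H by exact: Hc.
(* A value above [b] would be a fixed point of [s], so injectivity would make it equal to [b]. *)
have le_sb : s b <= b.
  rewrite leqNgt; apply/negP=> lt_bs.
  by have /perm_inj e := fix_s _ lt_bs; move: lt_bs; rewrite e ltnn.
(* Products act from the left factor on: [s] takes [b] to [s b], then [s b] steps of the cycle lead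
   to 0 and one more returns to [b]. The product thus fixes [b] as well as all points above it, and
   the induction hypothesis applies. *)
rewrite -(groupMr _ (groupX (s b).+1 Hb)); apply: IHm => [||i].
- exact: ltnW.
- by move=> c ltcm; apply: Hc; rewrite ltnS ltnW.
rewrite leq_eqVlt permM => /orP[/eqP e|lt_mi].
  have -> : i = b by apply: val_inj.
  rewrite expgSr permM (@prefix_cycle_exp _ _ i0) //.
  by apply: val_inj; rewrite /= prefix_cycleE /prefix_cycle_fun /=.
rewrite (fix_s i) //; elim: (s b).+1 => [|p IHp]; first by rewrite perm1.
rewrite expgSr permM IHp; apply: val_inj.
by rewrite /= prefix_cycleE /prefix_cycle_fun /= lt_mi.
Qed.

End PrefixCycle.

(** * Embedding of the symmetric group on [m] points into that on [n] points *)

Section WidenPerm.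
Variables (m n : nat) (le_mn : m <= n).
Implicit Type s : 'S_m.

Definition widen_perm_fun s (i : 'I_n) : 'I_n :=
  if insub (i : nat) is Some j then widen_ord le_mn (s j) else i.

Lemma widen_perm_fun_widen s j :
  widen_perm_fun s (widen_ord le_mn j) = widen_ord le_mn (s j).
Proof. by rewrite /widen_perm_fun /= valK. Qed.

Lemma widen_perm_fun_ge s (i : 'I_n) : m <= i -> widen_perm_fun s i = i.
Proof. by move=> le_mi; rewrite /widen_perm_fun insubN // -leqNgt. Qed.

(** A case view that exposes small points as [widen_ord le_mn j], the shape on which the evaluation
    rules rewrite. *)
Variant widen_spec : 'I_n -> Type :=
  | WidenLt j : widen_spec (widen_ord le_mn j)
  | WidenGe (i : 'I_n) of m <= i : widen_spec i.

Lemma widenP i : widen_spec i.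
Proof.
case: (ltnP i m) => [lt_im|]; last exact: WidenGe.
have -> : i = widen_ord le_mn (Ordinal lt_im) by apply: val_inj.
exact: WidenLt.
Qed.

Lemma widen_perm_funK s :
  cancel (widen_perm_fun s) (widen_perm_fun s^-1%g).
Proof.
move=> i; case: (widenP i) => [j|{}i le_mi]; last by rewrite !widen_perm_fun_ge.
by rewrite !widen_perm_fun_widen permK.
Qed.

Definition widen_perm s : 'S_n := perm (can_inj (widen_perm_funK s)).

Lemma widen_perm_widen s j :
  widen_perm s (widen_ord le_mn j) = widen_ord le_mn (s j).
Proof. by rewrite permE widen_perm_fun_widen. Qed.

Lemma widen_perm_ge s (i : 'I_n) : m <= i -> widen_perm s i = i.
Proof. by rewrite permE; exact: widen_perm_fun_ge. Qed.

Lemma widen_permM : {in [set: 'S_m] &, {morph widen_perm : s t / (s * t)%g}}.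
Proof.
move=> s t _ _; apply/permP=> i; rewrite permM.
case: (widenP i) => [j|{}i le_mi]; last by rewrite !widen_perm_ge.
by rewrite !widen_perm_widen permM.
Qed.

Canonical widen_perm_morphism := Morphism widen_permM.

Lemma injm_widen_perm : ('injm widen_perm)%g.
Proof.
apply/injmP=> s t _ _ e; apply/permP=> j; apply: val_inj.
have /(congr1 val) := widen_perm_widen s j.
by rewrite e widen_perm_widen => /esym.
Qed.

(** The formula [prefix_cycle_fun] does not mention the size of the ground set and fixes every point
    above [b]. *)
Lemma widen_prefix_cycle (b : 'I_m) :
  widen_perm (prefix_cycle b) = prefix_cycle (widen_ord le_mn b).
Proof.
apply/permP=> i; apply: val_inj; rewrite /= prefix_cycleE.
case: (widenP i) => [j|{}i le_mi].
  by rewrite widen_perm_widen /= prefix_cycleE.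
by rewrite widen_perm_ge // /prefix_cycle_fun /= (leq_trans (ltn_ord b) le_mi).
Qed.

End WidenPerm.

(** * Pattern containment and increasing tails *)

Lemma containsP (m n : nat) (s : 'S_n) (t : 'S_m) :
  reflect (exists f : 'I_m -> 'I_n,
             {homo f : i j / i < j} /\
             forall i j, (t i < t j) = (s (f i) < s (f j)))
          (contains s t).
Proof.
apply: (iffP existsP) => [[f occ_f]|[f [homo_f cmp_f]]].
  exists f; split=> i j; have /forallP/(_ i)/forallP/(_ j)/andP[] := occ_f.
    by move/implyP.
  by move=> _ /eqP.
exists (finfun f); apply/forallP=> i; apply/forallP=> j; rewrite !ffunE cmp_f.
by rewrite eqxx andbT; apply/implyP; exact: homo_f.
Qed.

Lemma contains3 (n : nat) (s : 'S_n) (t : 'S_3) (i j l : 'I_n) :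
    let o0 : 'I_3 := @Ordinal 3 0 isT in
    let o1 : 'I_3 := @Ordinal 3 1 isT in
    let o2 : 'I_3 := @Ordinal 3 2 isT in
    i < j -> j < l ->
    (t o0 < t o1) = (s i < s j) -> (t o0 < t o2) = (s i < s l) ->
    (t o1 < t o2) = (s j < s l) ->
  contains s t.
Proof.
move=> o0 o1 o2 ltij ltjl e01 e02 e12; apply/containsP.
pose f (x : 'I_3) := nth i [:: i; j; l] x.
have f_homo : {homo f : x y / x < y}.
  by case=> [[|[|[|x]]] ltx3] [[|[|[|y]]] lty3] //= _; apply: ltn_trans ltjl.
have cmp_lt (x y : 'I_3) :
    x < y -> (t x < t y) = (s (f x) < s (f y)).
  case: x y => [[|[|[|x]]] ltx3] [[|[|[|y]]] lty3] //= _;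
    rewrite /f /= -?e01 -?e02 -?e12;
    by congr (nat_of_ord (t _) < nat_of_ord (t _)); apply: val_inj.
exists f; split=> // x y; case: (ltngtP x y) => [|ltyx|/val_inj->].
- exact: cmp_lt.
(* By injectivity, a comparison in the reverse order is the negation of the direct one, so the three
   pairs in increasing order suffice. *)
- have perm_lt p (u : 'S_p) (v w : 'I_p) :
      v < w -> (u w < u v) = ~~ (u v < u w).
    move=> ltvw; have : u v <> u w :> nat.
      by move=> /val_inj/perm_inj e; move: ltvw; rewrite e ltnn.
    by lia.
  by rewrite (perm_lt _ t _ _ ltyx) (perm_lt _ s _ _ (f_homo _ _ ltyx)) cmp_lt.
- by rewrite !ltnn.
Qed.

(** Patterns inherit an increasing tail: an occurrence sends a positive index beyond the image of
    index 0, hence to a positive position. *)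
Lemma increasing_tail_avoids (m n : nat) (s : 'S_n) (t : 'S_m) :
  increasing_tail s -> ~ increasing_tail t -> avoids s t.
Proof.
move=> incr nincr; apply/negP=> /containsP[f [homo_f cmp_f]].
apply: nincr => i j i_gt0 ltij; rewrite cmp_f; apply: incr; last exact: homo_f.
pose o := Ordinal (ltn_trans i_gt0 (ltn_ord i)).
by have := homo_f o i i_gt0; lia.
Qed.

Lemma avoids_increasing_tail (n : nat) (s : 'S_n) :
  [/\ avoids s p132, avoids s p231 & avoids s p321] <-> increasing_tail s.
Proof.
have not_incr (t : 'S_3) :
    t (@Ordinal 3 2 isT) < t (@Ordinal 3 1 isT) -> ~ increasing_tail t.
  by move=> lt21 /(_ (@Ordinal 3 1 isT) (@Ordinal 3 2 isT) isT isT); lia.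
split=> [[av132 av231 av321] i j i_gt0 ltij|incr]; last first.
  by split; apply: increasing_tail_avoids => //;
    apply: not_incr; rewrite !permE.
pose o := Ordinal (ltn_trans i_gt0 (ltn_ord i)).
have neq (x y : 'I_n) : x < y -> s x <> s y :> nat.
  by move=> ltxy /val_inj/perm_inj e; move: ltxy; rewrite e ltnn.
have := neq _ _ ltij; have := neq o i i_gt0.
have := neq o j (ltn_trans i_gt0 ltij).
(* A descent at positive positions [i < j], preceded by position 0, forms 132, 231 or 321 according
   to whether [s o] lies below, between or above the two values. *)
case: (ltngtP (s i) (s j)) => // lt_ji neq_oj neq_oi _; exfalso.
case: (ltngtP (s o) (s j)) => // [lt_oj|lt_jo].
  by case/negP: av132; apply: (@contains3 _ _ _ o i j); rewrite ?permE /=; lia.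
case: (ltngtP (s o) (s i)) => // [lt_oi|lt_io].
  by case/negP: av231; apply: (@contains3 _ _ _ o i j); rewrite ?permE /=; lia.
by case/negP: av321; apply: (@contains3 _ _ _ o i j); rewrite ?permE /=; lia.
Qed.

(** * Avoidance of [theta k] and the isomorphism *)

Lemma thetaE (k : nat) (i : 'I_k) :
  theta k i = (if i == 0 :> nat then k.-1 else i.-1) :> nat.
Proof.
rewrite permE /=; case: i => [[|i] ltik] /=.
  by rewrite modn_small //; lia.
by rewrite modnDr modn_small // ltnW.
Qed.

Lemma avoids_prefix_cycle_theta (k n : nat) (b : 'I_n) :
  1 < k -> k <= n -> avoids (prefix_cycle b) (theta k) = (b < k.-1).
Proof.
move=> k_gt1 le_kn; rewrite ltnNge; congr (~~ _).
apply/containsP/idP => [[f [homo_f cmp_f]]|le_kb].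
  pose o := Ordinal (ltnW k_gt1).
  have f_ge (i : 'I_k) : i <= f i.
    case: i; elim=> [//|i IHi] ltik.
    by apply: leq_ltn_trans (IHi (ltnW ltik)) _; exact: homo_f.
  have lt_k : k.-1 < k by lia.
  pose l := Ordinal lt_k.
  (* The first entry of [theta k] exceeds its last. A prefix cycle has inversions only between
     position 0 and positions up to [b], so [k.-1 <= f l <= b]. *)
  have := cmp_f l o; rewrite !thetaE !prefix_cycleE /=.
  have := f_ge l; have := homo_f o l _; rewrite /=.
  have := prefix_cycle_funP b (f o); have := prefix_cycle_funP b (f l).
  by case: (k.-1 =P 0) => ?; lia.
(* The first [k] values are [b], 0, ..., [k - 2], with [b >= k - 1]: an occurrence of [theta k]. *)
exists (widen_ord le_kn); split=> // i j; rewrite !thetaE !prefix_cycleE /=.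
have := ltn_ord i; have := ltn_ord j.
have := prefix_cycle_funP b i; have := prefix_cycle_funP b j.
by case: eqP; case: eqP; lia.
Qed.

Theorem theorem4p1 (k n : nat) (k_ge2 : 2 <= k) (k_le_n : k <= n) :
  <<[set s : 'S_n | [&& avoids s p132, avoids s p231, avoids s p321
                      & avoids s (theta k)]]>>%g
    \isog [set: 'S_k.-1].
Proof.
set A := [set s | _].
have n_gt0 : 0 < n by lia.
have le_mn : k.-1 <= n by lia.
have mem_A (b : 'I_n) : b < k.-1 -> prefix_cycle b \in A.
  have /avoids_increasing_tail[av132 av231 av321] := prefix_cycle_increasing b.
  by move=> ltbk; rewrite inE avoids_prefix_cycle_theta // av132 av231 av321.
have A_mem s : s \in A -> exists2 b : 'I_n, b < k.-1 & s = prefix_cycle b.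
  rewrite inE => /and4P[av132 av231 av321].
  have incr : increasing_tail s by apply/avoids_increasing_tail.
  rewrite (increasing_tail_prefix_cycle (i0 := Ordinal n_gt0) erefl incr).
  by rewrite avoids_prefix_cycle_theta //; exists (s (Ordinal n_gt0)).
(* An injective morphism makes its image isomorphic to its domain, so it remains to identify the
   generated group with this image. *)
suff -> : <<A>>%g = (widen_perm_morphism le_mn @* [set: 'S_k.-1])%g.
  by rewrite isog_sym; apply: sub_isog => //; exact: injm_widen_perm.
apply/eqP; rewrite eqEsubset gen_subG; apply/andP; split.
  apply/subsetP=> _ /A_mem[b ltbk ->].
  have -> : b = widen_ord le_mn (Ordinal ltbk) by apply: val_inj.
  by rewrite -widen_prefix_cycle; apply: mem_morphim; rewrite inE.
apply/subsetP=> _ /morphimP[s _ _ ->].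
apply: (prefix_cycles_gen le_mn) => [b ltbk|i le_mi].
  exact/mem_gen/mem_A.
exact: widen_perm_ge.
Qed.
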